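(* Let $G$ be a finite group and $\omega\in Z^3_{\mathrm{gp}}(G,U(1))$. The representation group of the twisted Drinfeld double of $G$ is naturally isomorphic to the twisted equivariant K-group of $G$: $$\mathrm{Rep}(D^\omega(G))\cong{}^{\tau(\omega)}K_G(G^{\mathrm c}).$$
   Context: Three-cocycles. $\omega\in Z^3_{\mathrm{gp}}(G,U(1))$ is a function $G^3\to U(1)$, normalized ($\omega=1$ if any argument is $e$), with $\omega(h,g,f)\,\omega(kh,g,f)^{-1}\,\omega(k,hg,f)\,\omega(k,h,gf)^{-1}\,\omega(k,h,g)=1$ for all $k,h,g,f\in G$. Twisted Drinfeld double. $D^\omega(G)$ (as an algebra) is the complex algebra with basis $\{\langle\xleftarrow{g}x\rangle : g,x\in G\}$ and product $$\langle\xleftarrow{h}y\rangle\cdot\langle\xleftarrow{g}x\rangle:=\delta_{y,gxg^{-1}}\frac{\omega(h,g,x)\,\omega(hgx(hg)^{-1},h,g)}{\omega(h,gxg^{-1},g)}\langle\xleftarrow{hg}x\rangle;$$ its unit is $\sum_x\langle\xleftarrow{e}x\rangle$. $\mathrm{Rep}(D^\omega(G))$ is the Grothendieck group of its finite-dimensional (unital) complex representations. Twisted equivariant K-theory. $G^{\mathrm c}$ is the set $G$ with the conjugation action of $G$. Its action groupoid, which equals the loop groupoid $\Lambda\overline G$ of the one-object groupoid $\overline G$, has objects the elements $x\in G$ and a morphism $g\colon x\to gxg^{-1}$ for each $x,g\in G$, composition being multiplication. The transgression $\tau(\omega)\in Z^2(\Lambda\overline G,U(1))$ assigns to the composable pair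 $[h|g]x$, i.e. $hgx(hg)^{-1}\xleftarrow{h}gxg^{-1}\xleftarrow{g}x$, the value $\frac{\omega(h,g,x)\,\omega(hgxg^{-1}h^{-1},h,g)}{\omega(h,gxg^{-1},g)}$. For a two-cocycle $\theta$ on a finite groupoid $\mathcal G$, a $\theta$-twisted representation $F$ assigns to each object a finite-dimensional complex vector space $F(x)$ and to each morphism $g\colon x_1\to x_2$ a linear map $F(g)\colon F(x_1)\to F(x_2)$ with $F(\mathrm{id}_x)=\mathrm{id}$ and $F(g_2)F(g_1)=\theta([g_2|g_1])F(g_2\circ g_1)$; morphisms $F\Rightarrow F'$ are families of linear maps $T(x)\colon F(x)\to F'(x)$ with $T(y)F(g)=F'(g)T(x)$ for $g\colon x\to y$; $\mathrm{Rep}^\theta(\mathcal G)$ is the Grothendieck group of this category. By definition, ${}^{\tau(\omega)}K_G(G^{\mathrm c}):=\mathrm{Rep}^{\tau(\omega)}(\Lambda\overline G)$. *)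

(* Defs.v *)
From HB Require Import structures.
From mathcomp Require Import all_boot all_order all_algebra all_fingroup.
From mathcomp Require Import complex boolp reals ring.

Set Implicit Arguments.
Unset Strict Implicit.
Unset Printing Implicit Defensive.

Import Order.TTheory GRing.Theory Num.Theory.

Local Open Scope ring_scope.

(* The Grothendieck group of a category with objects T and short exact
   sequences 0 -> A -> B -> D -> 0 given by ses A B D: the abelian group
   presented by the generators [A], A : T, and the relations
   [B] = [A] + [D] for ses A B D.  It is not declared as a zmodType because T
   (e.g. representations on arbitrary vectTypes) lives in a universe too large
   for the MathComp hierarchy; elements are classes of group words. *)

Section Grothendieck.
Variables (T : Type) (ses : T -> T -> T -> Prop).

Inductive groth_word : Type :=
  | GrothZero
  | GrothGen of T
  | GrothOpp of groth_word
  | GrothAdd of groth_word & groth_word.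

Inductive groth_rel : groth_word -> groth_word -> Prop :=
  | groth_refl a : groth_rel a a
  | groth_sym a b : groth_rel a b -> groth_rel b a
  | groth_trans a b c : groth_rel a b -> groth_rel b c -> groth_rel a c
  | groth_congN a b :
      groth_rel a b -> groth_rel (GrothOpp a) (GrothOpp b)
  | groth_congD a a' b b' : groth_rel a a' -> groth_rel b b' ->
      groth_rel (GrothAdd a b) (GrothAdd a' b')
  | groth_relA a b c :
      groth_rel (GrothAdd a (GrothAdd b c)) (GrothAdd (GrothAdd a b) c)
  | groth_relC a b : groth_rel (GrothAdd a b) (GrothAdd b a)
  | groth_rel0 a : groth_rel (GrothAdd GrothZero a) a
  | groth_relN a : groth_rel (GrothAdd (GrothOpp a) a) GrothZero
  | groth_rel_ses A B D : ses A B D ->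
      groth_rel (GrothGen B) (GrothAdd (GrothGen A) (GrothGen D)).

Definition grothendieck : Type :=
  {P : groth_word -> Prop | exists a, P = groth_rel a}.

Definition groth_pi (a : groth_word) : grothendieck :=
  exist _ (groth_rel a) (ex_intro _ a erefl).

Definition groth_repr (x : grothendieck) : groth_word :=
  projT1 (cid (projT2 x)).

Definition groth_zero : grothendieck := groth_pi GrothZero.
Definition groth_opp (x : grothendieck) : grothendieck :=
  groth_pi (GrothOpp (groth_repr x)).
Definition groth_add (x y : grothendieck) : grothendieck :=
  groth_pi (GrothAdd (groth_repr x) (groth_repr y)).
Definition groth_class (A : T) : grothendieck := groth_pi (GrothGen A).

Lemma groth_piP a b : groth_pi a = groth_pi b <-> groth_rel a b.
Proof.
split=> [E|ab].
  have -> : groth_rel a = groth_rel b by exact: (congr1 (@proj1_sig _ _) E).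
  exact: groth_refl.
apply: (@eq_exist _ _ _ _ _ _); apply: funext => c; apply: propext; split.
  by move=> ac; apply: groth_trans (groth_sym ab) ac.
exact: groth_trans.
Qed.

Lemma groth_reprK x : groth_pi (groth_repr x) = x.
Proof.
rewrite /groth_repr; case: x => P p /=; case: cid => a /= E.
exact/eq_exist.
Qed.

Lemma groth_reprP a : groth_rel (groth_repr (groth_pi a)) a.
Proof. by apply/groth_piP; rewrite groth_reprK. Qed.

Lemma groth_oppE a : groth_opp (groth_pi a) = groth_pi (GrothOpp a).
Proof. by apply/groth_piP/groth_congN/groth_reprP. Qed.

Lemma groth_addE a b :
  groth_add (groth_pi a) (groth_pi b) = groth_pi (GrothAdd a b).
Proof. by apply/groth_piP; apply: groth_congD; apply: groth_reprP. Qed.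

Lemma groth_addA : associative groth_add.
Proof.
move=> x y z; rewrite -(groth_reprK x) -(groth_reprK y) -(groth_reprK z).
move: (groth_repr x) (groth_repr y) (groth_repr z) => a b c.
rewrite (groth_addE b c) (groth_addE a b) !groth_addE.
by apply/groth_piP; apply: groth_relA.
Qed.

Lemma groth_addC : commutative groth_add.
Proof. by move=> x y; apply/groth_piP; apply: groth_relC. Qed.

Lemma groth_add0 : left_id groth_zero groth_add.
Proof.
move=> x; rewrite -(groth_reprK x) groth_addE.
by apply/groth_piP; apply: groth_rel0.
Qed.

Lemma groth_addN : left_inverse groth_zero groth_opp groth_add.
Proof.
move=> x; rewrite -(groth_reprK x) groth_oppE groth_addE.
by apply/groth_piP; apply: groth_relN.
Qed.

Lemma groth_class_ses A B D : ses A B D ->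
  groth_class B = groth_add (groth_class A) (groth_class D).
Proof. by move=> h; rewrite groth_addE; apply/groth_piP/groth_rel_ses. Qed.

End Grothendieck.

Section ShortExact.
Variables (C : fieldType) (U V W : vectType C).

Definition short_exact (f : 'Hom(U, V)) (g : 'Hom(V, W)) : Prop :=
  [/\ lker f = 0%VS, limg f = lker g & limg g = fullv].

End ShortExact.

Record algRep (C : fieldType) (A : algType C) : Type := AlgRep {
  rep_space : vectType C;
  rep_act : {linear A -> 'End(rep_space)};
  rep_act1 : rep_act 1 = \1%VF;
  rep_actM : forall a b, rep_act (a * b) = (rep_act a \o rep_act b)%VF
}.

Section AlgRep.
Variables (C : fieldType) (A : algType C).

Definition algRep_morph (V W : algRep A)
    (f : 'Hom(rep_space V, rep_space W)) : Prop :=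
  forall a, (f \o rep_act V a)%VF = (rep_act W a \o f)%VF.

Definition algRep_ses (U V W : algRep A) : Prop :=
  exists (f : 'Hom(rep_space U, rep_space V))
         (g : 'Hom(rep_space V, rep_space W)),
    [/\ algRep_morph f, algRep_morph g & short_exact f g].

Definition rep_group : Type := grothendieck algRep_ses.
Definition rep_class (V : algRep A) : rep_group := groth_class algRep_ses V.

End AlgRep.

Record finGroupoid : Type := FinGroupoid {
  gob :> finType;
  ghom : gob -> gob -> finType;
  gid : forall x, ghom x x;
  gcomp : forall x y z, ghom y z -> ghom x y -> ghom x z;
  ginv : forall x y, ghom x y -> ghom y x;
  gcompA : forall x y z w (k : ghom z w) (h : ghom y z) (g : ghom x y),
    gcomp k (gcomp h g) = gcomp (gcomp k h) g;
  gcomp_idl : forall x y (g : ghom x y), gcomp (gid y) g = g;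
  gcomp_idr : forall x y (g : ghom x y), gcomp g (gid x) = g;
  gcomp_invl : forall x y (g : ghom x y), gcomp (ginv g) g = gid x;
  gcomp_invr : forall x y (g : ghom x y), gcomp g (ginv g) = gid y
}.

(* U(1) is the unit circle {z : C | `|z| = 1}. *)

Record cocycle2 (C : numClosedFieldType) (X : finGroupoid) : Type := Cocycle2 {
  coc2 :> forall x y z : X, ghom y z -> ghom x y -> C;
  coc2_norm : forall x y z (h : ghom y z) (g : ghom x y), `|coc2 h g| = 1;
  coc2P : forall x y z w (k : ghom z w) (h : ghom y z) (g : ghom x y),
    coc2 h g * (coc2 (gcomp k h) g)^-1 * coc2 k (gcomp h g)
      * (coc2 k h)^-1 = 1
}.

Record twistedRep (C : numClosedFieldType) (X : finGroupoid)
    (theta : cocycle2 C X) : Type := TwistedRep {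
  trep_space : X -> vectType C;
  trep_map : forall x y : X,
    ghom x y -> 'Hom(trep_space x, trep_space y);
  trep_map1 : forall x, trep_map (gid x) = \1%VF;
  trep_mapM : forall x y z (h : ghom y z) (g : ghom x y),
    (trep_map h \o trep_map g)%VF = theta x y z h g *: trep_map (gcomp h g)
}.

Section TwistedRep.
Variables (C : numClosedFieldType) (X : finGroupoid) (theta : cocycle2 C X).

Definition trep_morph (E F : twistedRep theta)
    (t : forall x, 'Hom(trep_space E x, trep_space F x)) : Prop :=
  forall x y (g : ghom x y),
    (t y \o trep_map E g)%VF = (trep_map F g \o t x)%VF.

Definition trep_ses (E F H : twistedRep theta) : Prop :=
  exists (s : forall x, 'Hom(trep_space E x, trep_space F x))
         (t : forall x, 'Hom(trep_space F x, trep_space H x)),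
    [/\ trep_morph s, trep_morph t & forall x, short_exact (s x) (t x)].

Definition trep_group : Type := grothendieck trep_ses.
Definition trep_class (F : twistedRep theta) : trep_group :=
  groth_class trep_ses F.

End TwistedRep.

Section ConjugationGroupoid.
Variable gT : finGroupType.
Implicit Types x y z : gT.

(* Conjugation acts on the left by g x g^-1, whereas x ^ g = g^-1 x g. *)
Definition cj (g x : gT) : gT := (g * x * g^-1)%g.

Lemma cj1 x : cj 1%g x = x.
Proof. by rewrite /cj mul1g invg1 mulg1. Qed.

Lemma cjM h g x : cj (h * g)%g x = cj h (cj g x).
Proof. by rewrite /cj invMg !mulgA. Qed.

Definition loop_hom x y : finType := {g : gT | y == cj g x}.

Lemma loop_id_subproof x : x == cj 1%g x.
Proof. by rewrite cj1. Qed.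

Lemma loop_comp_subproof x y z (h : loop_hom y z) (g : loop_hom x y) :
  z == cj (val h * val g)%g x.
Proof. by rewrite cjM -(eqP (valP g)); apply: (valP h). Qed.

Lemma loop_inv_subproof x y (g : loop_hom x y) : x == cj (val g)^-1%g y.
Proof. by rewrite [X in cj _ X](eqP (valP g)) -cjM mulVg cj1. Qed.

Definition loop_id x : loop_hom x x := Sub 1%g (loop_id_subproof x).
Definition loop_comp x y z (h : loop_hom y z) (g : loop_hom x y) :
  loop_hom x z := Sub (val h * val g)%g (loop_comp_subproof h g).
Definition loop_inv x y (g : loop_hom x y) : loop_hom y x :=
  Sub (val g)^-1%g (loop_inv_subproof g).

Lemma loop_compA x y z w
    (k : loop_hom z w) (h : loop_hom y z) (g : loop_hom x y) :
  loop_comp k (loop_comp h g) = loop_comp (loop_comp k h) g.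
Proof. by apply: val_inj; rewrite /= mulgA. Qed.

Lemma loop_comp_idl x y (g : loop_hom x y) : loop_comp (loop_id y) g = g.
Proof. by apply: val_inj; rewrite /= mul1g. Qed.

Lemma loop_comp_idr x y (g : loop_hom x y) : loop_comp g (loop_id x) = g.
Proof. by apply: val_inj; rewrite /= mulg1. Qed.

Lemma loop_comp_invl x y (g : loop_hom x y) :
  loop_comp (loop_inv g) g = loop_id x.
Proof. by apply: val_inj; rewrite /= mulVg. Qed.

Lemma loop_comp_invr x y (g : loop_hom x y) :
  loop_comp g (loop_inv g) = loop_id y.
Proof. by apply: val_inj; rewrite /= mulgV. Qed.

Definition loop_groupoid : finGroupoid :=
  FinGroupoid loop_compA loop_comp_idl loop_comp_idr
              loop_comp_invl loop_comp_invr.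

End ConjugationGroupoid.

Record cocycle3 (C : numClosedFieldType) (gT : finGroupType) : Type :=
  Cocycle3 {
  coc3 :> gT -> gT -> gT -> C;
  coc3_norm : forall k h g, `|coc3 k h g| = 1;
  coc3_1l : forall h g, coc3 1%g h g = 1;
  coc3_1m : forall k g, coc3 k 1%g g = 1;
  coc3_1r : forall k h, coc3 k h 1%g = 1;
  coc3P : forall k h g f,
    coc3 h g f * (coc3 (k * h)%g g f)^-1 * coc3 k (h * g)%g f
      * (coc3 k h (g * f)%g)^-1 * coc3 k h g = 1
}.

Section Transgression.
Variables (C : numClosedFieldType) (gT : finGroupType).
Variable omega : cocycle3 C gT.

Definition tau (h g x : gT) : C :=
  omega h g x * omega (cj (h * g)%g x) h g / omega h (cj g x) g.

Lemma coc3_neq0 k h g : omega k h g != 0.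
Proof. by rewrite -normr_eq0 coc3_norm oner_eq0. Qed.

Lemma tau_norm h g x : `|tau h g x| = 1.
Proof. by rewrite /tau normf_div normrM !coc3_norm mulr1 divr1. Qed.

Lemma tau_neq0 h g x : tau h g x != 0.
Proof. by rewrite -normr_eq0 tau_norm oner_eq0. Qed.

Lemma tau1g g x : tau 1%g g x = 1.
Proof. by rewrite /tau !(coc3_1l, coc3_1m) mulr1 divr1. Qed.

Lemma taug1 g x : tau g 1%g x = 1.
Proof. by rewrite /tau !(coc3_1r, coc3_1m) mulr1 divr1. Qed.

Lemma coc3E k h g f :
  omega h g f * omega k (h * g)%g f * omega k h g
  = omega (k * h)%g g f * omega k h (g * f)%g.
Proof.
have := coc3P omega k h g f.
move: (coc3_neq0 (k * h)%g g f) (coc3_neq0 k h (g * f)%g).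
set a := omega (k * h)%g g f; set b := omega k h (g * f)%g => a0 b0 E.
move: (omega h g f) (omega k _ f) (omega k h g) E => p q c E.
have -> : p * q * c = (p * a^-1 * q * b^-1 * c) * (a * b).
  by field; apply/andP.
by rewrite E mul1r.
Qed.

Let transgr (p1 q1 r1 p2 q2 r2 p3 q3 r3 p4 q4 r4 a b c d : C) :
  r1 != 0 -> r2 != 0 -> r3 != 0 -> r4 != 0 -> b != 0 -> c != 0 ->
  p2 != 0 -> q2 != 0 ->
  p1 * p2 * c = p4 * a -> r1 * b * p3 = r4 * a ->
  q1 * b * r3 = d * r2 -> c * q4 * q3 = d * q2 ->
  p1 * q1 / r1 * (p2 * q2 / r2) = p3 * q3 / r3 * (p4 * q4 / r4).
Proof.
move=> r10 r20 r30 r40 b0 c0 p20 q20 E1 E2 E3 E4.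
have Ea : a = r1 * b * p3 / r4 by rewrite E2 mulrAC mulfV // mul1r.
have Ep : p1 = p4 * a / (p2 * c) by rewrite -E1 -(mulrA p1) mulfK ?mulf_neq0.
have Ed : d = c * q4 * q3 / q2 by rewrite E4 mulfK.
have Eq : q1 = d * r2 / (b * r3) by rewrite -E3 -(mulrA q1) mulfK ?mulf_neq0.
by rewrite Eq Ep Ed Ea; field; do !(apply/andP; split).
Qed.

Lemma tauP k h g x :
  tau h g x * tau k (h * g)%g x = tau k h (cj g x) * tau (k * h)%g g x.
Proof.
have E1 := coc3E k h g x; have E2 := coc3E k h (cj g x) g.
have E3 := coc3E k (cj (h * g)%g x) h g.
have E4 := coc3E (cj (k * (h * g))%g x) k h g.
have e2 : (cj g x * g = g * x)%g by rewrite /cj mulgKV.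
have e3 : (cj (h * g) x * h = h * cj g x)%g by rewrite cjM {1}/cj mulgKV.
have e4 : (cj (k * (h * g)) x * k = k * cj (h * g) x)%g.
  by rewrite cjM {1}/cj mulgKV.
rewrite e2 in E2; rewrite e3 in E3; rewrite e4 in E4.
have -> : tau k h (cj g x) = omega k h (cj g x) *
    omega (cj (k * (h * g))%g x) k h / omega k (cj (h * g)%g x) h.
  by rewrite /tau -!cjM mulgA.
by rewrite {3}/tau -mulgA; apply: transgr E1 E2 E3 E4; apply: coc3_neq0.
Qed.

Definition transgression_fun (x y z : loop_groupoid gT)
    (h : ghom y z) (g : ghom x y) : C := tau (val h) (val g) x.

Lemma transgression_norm (x y z : loop_groupoid gT)
  (h : ghom y z) (g : ghom x y) : `|transgression_fun h g| = 1.
Proof. exact: tau_norm. Qed.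

Lemma transgressionP (x y z w : loop_groupoid gT)
    (k : ghom z w) (h : ghom y z) (g : ghom x y) :
  transgression_fun h g * (transgression_fun (gcomp k h) g)^-1
    * transgression_fun k (gcomp h g) * (transgression_fun k h)^-1 = 1.
Proof.
have Ey : y = cj (val g) x by apply/eqP/(valP g).
have := tauP (val k) (val h) (val g) x; rewrite -Ey /transgression_fun /=.
have := tau_neq0 (val k) (val h) y; have := tau_neq0 (val k * val h)%g (val g) x.
move=> b0 a0 E; rewrite [X in X / _]mulrAC E.
by rewrite mulfK // mulfV.
Qed.

Definition transgression : cocycle2 C (loop_groupoid gT) :=
  Cocycle2 transgression_norm transgressionP.

End Transgression.

(* The basis vector indexed by (g, x) is <-g- x>; an element of D^omega(G) is
   its family of coordinates. *)
Definition drinfeld_double (C : numClosedFieldType) (gT : finGroupType)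
  (omega : cocycle3 C gT) : Type := {ffun gT * gT -> C^o}.

Section DrinfeldDouble.
Variables (C : numClosedFieldType) (gT : finGroupType).
Variable omega : cocycle3 C gT.

Local Notation D := (drinfeld_double omega).

HB.instance Definition _ := GRing.Lmodule.copy D {ffun gT * gT -> C^o}.

Definition dd_basis (g x : gT) : D := [ffun p => (p == (g, x))%:R].

Definition dd_basis_mul (p q : gT * gT) : D :=
  if p.2 == cj q.1 q.2 then
    tau omega p.1 q.1 q.2 *: dd_basis (p.1 * q.1)%g q.2
  else 0.

Definition dd_mul (a b : D) : D :=
  \sum_(p : gT * gT) \sum_(q : gT * gT) (a p * b q) *: dd_basis_mul p q.

Definition dd_one : D := \sum_(x : gT) dd_basis 1%g x.

Lemma dd_ffunD (a b : D) p : (a + b) p = a p + b p.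
Proof. by rewrite ffunE. Qed.

Lemma dd_ffunZ c (a : D) p : (c *: a) p = c * a p.
Proof. by rewrite ffunE. Qed.

Lemma dd_basisE g x p : dd_basis g x p = (p == (g, x))%:R.
Proof. by rewrite ffunE. Qed.

Lemma dd_decomp (a : D) : a = \sum_p a p *: dd_basis p.1 p.2.
Proof.
apply/ffunP=> q; rewrite sum_ffunE (bigD1 q) //= big1 ?addr0 => [|p pq].
  by rewrite dd_ffunZ dd_basisE -surjective_pairing eqxx mulr1.
by rewrite dd_ffunZ dd_basisE -surjective_pairing eq_sym (negPf pq) mulr0.
Qed.

Lemma dd_mulDl : left_distributive dd_mul +%R.
Proof.
move=> a b c; rewrite /dd_mul -big_split; apply: eq_bigr => p _ /=.
rewrite -big_split; apply: eq_bigr => q _ /=.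
by rewrite dd_ffunD mulrDl scalerDl.
Qed.

Lemma dd_mulDr : right_distributive dd_mul +%R.
Proof.
move=> a b c; rewrite /dd_mul -big_split; apply: eq_bigr => p _ /=.
rewrite -big_split; apply: eq_bigr => q _ /=.
by rewrite dd_ffunD mulrDr scalerDl.
Qed.

Lemma dd_mulZl c (a b : D) : c *: dd_mul a b = dd_mul (c *: a) b.
Proof.
rewrite /dd_mul scaler_sumr; apply: eq_bigr => p _.
rewrite scaler_sumr; apply: eq_bigr => q _.
by rewrite dd_ffunZ scalerA mulrA.
Qed.

Lemma dd_mulZr c (a b : D) : c *: dd_mul a b = dd_mul a (c *: b).
Proof.
rewrite /dd_mul scaler_sumr; apply: eq_bigr => p _.
rewrite scaler_sumr; apply: eq_bigr => q _.
by rewrite dd_ffunZ scalerA mulrCA.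
Qed.

Lemma dd_mul_sumr (I : finType) (a : D) (F : I -> D) :
  dd_mul a (\sum_i F i) = \sum_i dd_mul a (F i).
Proof.
apply: (big_morph (dd_mul a)) => [x y|]; first exact: dd_mulDr.
by rewrite -[X in dd_mul _ X](scale0r (0 : D)) -dd_mulZr scale0r.
Qed.

Lemma dd_mul_suml (I : finType) (a : D) (F : I -> D) :
  dd_mul (\sum_i F i) a = \sum_i dd_mul (F i) a.
Proof.
apply: (big_morph (dd_mul^~ a)) => [x y|]; first exact: dd_mulDl.
by rewrite -[X in dd_mul X _](scale0r (0 : D)) -dd_mulZl scale0r.
Qed.

Lemma dd_mul_basis h y g x :
  dd_mul (dd_basis h y) (dd_basis g x) =
  if y == cj g x then tau omega h g x *: dd_basis (h * g)%g x else 0.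
Proof.
rewrite /dd_mul (bigD1 (h, y)) //= [X in _ + X]big1 ?addr0 => [|p ph].
  rewrite (bigD1 (g, x)) //= big1 ?addr0 => [|q qg].
    by rewrite !dd_basisE !eqxx mulr1 scale1r.
  by rewrite dd_basisE dd_basisE (negPf qg) mulr0 scale0r.
by apply: big1 => q _; rewrite dd_basisE (negPf ph) mul0r scale0r.
Qed.

Lemma dd_mul0r (a : D) : dd_mul a 0 = 0.
Proof. by rewrite -(scale0r (0 : D)) -dd_mulZr !scale0r. Qed.

Lemma dd_mul0l (a : D) : dd_mul 0 a = 0.
Proof. by rewrite -(scale0r (0 : D)) -dd_mulZl !scale0r. Qed.

Lemma dd_mulA_basis (p q r : gT * gT) :
  dd_mul (dd_basis p.1 p.2) (dd_mul (dd_basis q.1 q.2) (dd_basis r.1 r.2)) =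
  dd_mul (dd_mul (dd_basis p.1 p.2) (dd_basis q.1 q.2)) (dd_basis r.1 r.2).
Proof.
case: p q r => [k z] [h y] [g x] /=; rewrite !dd_mul_basis.
have [->|yx] := eqVneq y (cj g x).
  rewrite -dd_mulZr dd_mul_basis cjM.
  have [_|zy] := eqVneq z (cj h (cj g x)); last by rewrite scaler0 dd_mul0l.
  by rewrite -dd_mulZl dd_mul_basis eqxx !scalerA tauP mulgA.
rewrite dd_mul0r; case: eqP => [_|_]; last by rewrite dd_mul0l.
by rewrite -dd_mulZl dd_mul_basis (negPf yx) scaler0.
Qed.

Lemma dd_mulA : associative dd_mul.
Proof.
move=> a b c; rewrite [a]dd_decomp [b]dd_decomp [c]dd_decomp.
rewrite [LHS]dd_mul_suml (dd_mul_suml (\sum_p b p *: _)) [RHS]dd_mul_suml.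
apply: eq_bigr => p _.
rewrite (dd_mul_suml (\sum_p c p *: _)) [LHS]dd_mul_sumr.
rewrite (dd_mul_sumr (a p *: _)) [RHS]dd_mul_suml; apply: eq_bigr => q _.
rewrite (dd_mul_sumr (b q *: _)) [LHS]dd_mul_sumr [RHS]dd_mul_sumr.
apply: eq_bigr => r _.
rewrite -!(dd_mulZl, dd_mulZr) dd_mulA_basis !scalerA.
by congr (_ *: _); ring.
Qed.

Lemma dd_mul1l : left_id dd_one dd_mul.
Proof.
move=> a; rewrite [a]dd_decomp dd_mul_sumr; apply: eq_bigr => -[g x] _ /=.
rewrite -dd_mulZr /dd_one dd_mul_suml (bigD1 (cj g x)) //=.
rewrite dd_mul_basis eqxx tau1g scale1r mul1g big1 ?addr0 // => y yx.
by rewrite dd_mul_basis (negPf yx).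
Qed.

Lemma dd_mul1r : right_id dd_one dd_mul.
Proof.
move=> a; rewrite [a]dd_decomp dd_mul_suml; apply: eq_bigr => -[g x] _ /=.
rewrite -dd_mulZl /dd_one dd_mul_sumr (bigD1 x) //=.
rewrite dd_mul_basis cj1 eqxx taug1 scale1r mulg1 big1 ?addr0 // => y yx.
by rewrite dd_mul_basis cj1 eq_sym (negPf yx).
Qed.

Lemma dd_one_neq0 : dd_one != 0.
Proof.
apply/eqP=> /ffunP/(_ (1%g, 1%g)) /eqP; rewrite /dd_one sum_ffunE [X in _ == X]ffunE.
rewrite (bigD1 1%g) //= big1 ?addr0 => [|x x1]; rewrite dd_basisE.
  by rewrite eqxx oner_eq0.
by rewrite xpair_eqE eqxx eq_sym (negPf x1).
Qed.

HB.instance Definition _ := GRing.Zmodule_isNzRing.Build D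
  dd_mulA dd_mul1l dd_mul1r dd_mulDl dd_mulDr dd_one_neq0.
HB.instance Definition _ := GRing.Lmodule_isLalgebra.Build C D dd_mulZl.
HB.instance Definition _ := GRing.Lalgebra_isAlgebra.Build C D dd_mulZr.

Lemma dd_basisM h y g x :
  dd_basis h y * dd_basis g x =
  if y == cj g x then tau omega h g x *: dd_basis (h * g)%g x else 0.
Proof. exact: dd_mul_basis. Qed.

End DrinfeldDouble.

Section SupportRep.
Variables (C : numClosedFieldType) (gT : finGroupType).
Variables (omega : cocycle3 C gT) (V : algRep (drinfeld_double omega)).

(* The twisted representation carried by V: F(x) = <-e- x> V, on which the
   arrow g : x -> g x g^-1 acts as <-g- x>. *)
Definition supp_space (x : gT) : {vspace rep_space V} :=
  limg (rep_act V (dd_basis omega 1%g x)).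

Definition supp_map (x y : loop_groupoid gT) (g : ghom x y) :
    'Hom(subvs_of (supp_space x), subvs_of (supp_space y)) :=
  (linfun (vsproj (supp_space y)) \o rep_act V (dd_basis omega (val g) x)
   \o linfun vsval)%VF.

Lemma supp_act1 x v : v \in supp_space x ->
  rep_act V (dd_basis omega 1%g x) v = v.
Proof.
case/memv_imgP=> u _ ->; rewrite -comp_lfunE -rep_actM dd_basisM cj1 eqxx.
by rewrite tau1g scale1r mulg1.
Qed.

Lemma supp_act_mem g x v :
  rep_act V (dd_basis omega g x) v \in supp_space (cj g x).
Proof.
have -> : dd_basis omega g x = dd_basis omega 1%g (cj g x) * dd_basis omega g x.
  by rewrite dd_basisM eqxx tau1g scale1r mul1g.
by rewrite rep_actM comp_lfunE memv_img ?memvf.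
Qed.

Lemma supp_mapE (x y : loop_groupoid gT) (g : ghom x y) u :
  vsval (supp_map g u) = rep_act V (dd_basis omega (val g) x) (vsval u).
Proof.
rewrite /supp_map !comp_lfunE !lfunE /= vsprojK //.
by have := supp_act_mem (val g) x (vsval u); rewrite -(eqP (valP g)).
Qed.

Lemma supp_map1 (x : loop_groupoid gT) : supp_map (gid x) = \1%VF.
Proof.
apply/lfunP=> u; apply: subvs_inj; rewrite supp_mapE lfunE /=.
by rewrite supp_act1 // subvsP.
Qed.

Lemma supp_mapM (x y z : loop_groupoid gT) (h : ghom y z) (g : ghom x y) :
  (supp_map h \o supp_map g)%VF
  = transgression omega x y z h g *: supp_map (gcomp h g).
Proof.
apply/lfunP=> u; apply: subvs_inj.
rewrite scale_lfunE comp_lfunE linearZ /= !supp_mapE.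
rewrite -comp_lfunE -rep_actM dd_basisM (valP g).
by rewrite linearZ /= scale_lfunE.
Qed.

Definition supp_rep : twistedRep (transgression omega) :=
  TwistedRep supp_map1 supp_mapM.

End SupportRep.

Section TwistedK.
Variables (C : numClosedFieldType) (gT : finGroupType).
Variable omega : cocycle3 C gT.

Definition twisted_K : Type := trep_group (transgression omega).
Definition twisted_K_class : twistedRep (transgression omega) -> twisted_K :=
  @trep_class C (loop_groupoid gT) (transgression omega).
Definition twisted_K_add : twisted_K -> twisted_K -> twisted_K :=
  @groth_add _ (@trep_ses C (loop_groupoid gT) (transgression omega)).

Definition dd_rep_group : Type := rep_group (drinfeld_double omega).
Definition dd_rep_class :
    algRep (drinfeld_double omega) -> dd_rep_group :=
  @rep_class C (drinfeld_double omega).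
Definition dd_rep_add : dd_rep_group -> dd_rep_group -> dd_rep_group :=
  @groth_add _ (@algRep_ses C (drinfeld_double omega)).

End TwistedK.

(* Main.v *)
(* A module V over D^omega(G) splits as the direct sum of the images of the
   orthogonal idempotents <-e- x>, and <-g- x> maps the x-summand to the
   (g x g^-1)-summand with exactly the composition law of a tau(omega)-twisted
   representation. Conversely the direct sum of the spaces of a twisted
   representation is a module on which <-g- x> acts as F(g) after projection to
   F(x). These constructions are exact and mutually inverse up to isomorphism,
   hence induce inverse maps of Grothendieck groups; isomorphic objects have
   equal classes because A -> B -> 0 is then short exact and [0] = 0. *)

Require Import Defs.
From HB Require Import structures.
From mathcomp Require Import all_boot all_order all_algebra all_fingroup.
From mathcomp Require Import complex boolp reals.

Set Implicit Arguments.
Unset Strict Implicit.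
Unset Printing Implicit Defensive.

Import GRing.Theory.
Import VectorInternalTheory.

Local Open Scope ring_scope.

(** * Maps of Grothendieck groups induced by exact assignments on objects *)

Section GrothendieckFunctoriality.
Variables (T U : Type) (sesT : T -> T -> T -> Prop) (sesU : U -> U -> U -> Prop).
Variable f : T -> U.
Hypothesis f_exact : forall A B D, sesT A B D -> sesU (f A) (f B) (f D).

Fixpoint groth_word_map (a : groth_word T) : groth_word U :=
  match a with
  | GrothZero => GrothZero U
  | GrothGen A => GrothGen (f A)
  | GrothOpp a => GrothOpp (groth_word_map a)
  | GrothAdd a b => GrothAdd (groth_word_map a) (groth_word_map b)
  end.

Definition groth_map (x : grothendieck sesT) : grothendieck sesU :=
  groth_pi sesU (groth_word_map (groth_repr x)).

Lemma groth_word_map_rel a b : groth_rel sesT a b ->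
  groth_rel sesU (groth_word_map a) (groth_word_map b).
Proof.
elim=> {a b} /=.
- by move=> a; apply: groth_refl.
- by move=> a b _; apply: groth_sym.
- by move=> a b c _ ab _; apply: groth_trans.
- by move=> a b _; apply: groth_congN.
- by move=> a a' b b' _ aa' _; apply: groth_congD.
- by move=> a b c; apply: groth_relA.
- by move=> a b; apply: groth_relC.
- by move=> a; apply: groth_rel0.
- by move=> a; apply: groth_relN.
- by move=> A B D /f_exact; apply: groth_rel_ses.
Qed.

(** Independence of the word picked by [groth_repr]: related words have related images because [f]
    sends short exact sequences to short exact sequences. *)
Lemma groth_map_pi a :
  groth_map (groth_pi sesT a) = groth_pi sesU (groth_word_map a).
Proof. exact/groth_piP/groth_word_map_rel/groth_reprP. Qed.

Lemma groth_mapD :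
  {morph groth_map : x y / groth_add x y >-> groth_add x y}.
Proof.
by move=> x y; rewrite {1}/groth_add groth_map_pi /groth_map groth_addE.
Qed.

End GrothendieckFunctoriality.

(** * Isomorphic objects and induced inverse maps *)

Section GrothendieckIso.
Variables (T : Type) (ses : T -> T -> T -> Prop).

(** The first sequence gives [[Z] = [Z] + [Z]], so [[Z] = 0] by cancellation, and the second then
    reads [[B] = [A]]. Only sequences are mentioned, so modules and twisted representations are both
    covered. *)
Lemma groth_rel_iso Z A B : ses Z Z Z -> ses A B Z ->
  groth_rel ses (GrothGen B) (GrothGen A).
Proof.
move=> sesZ sesB; apply/groth_piP.
have EZ := groth_class_ses sesZ; have EB := groth_class_ses sesB.
have Z0 : groth_class ses Z = groth_zero ses.
  rewrite -(groth_addN (groth_class ses Z)) [X in groth_add _ X]EZ.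
  by rewrite groth_addA groth_addN groth_add0.
by rewrite -/(groth_class ses B) EB Z0 groth_addC groth_add0.
Qed.

End GrothendieckIso.

(** Both maps commute with the word constructors, so induction on words leaves only the generators
    to check. *)
Lemma groth_mapK (T U : Type) (sesT : T -> T -> T -> Prop)
    (sesU : U -> U -> U -> Prop) (f : T -> U) (g : U -> T) :
  (forall A B D, sesT A B D -> sesU (f A) (f B) (f D)) ->
  (forall A B D, sesU A B D -> sesT (g A) (g B) (g D)) ->
  (forall A, groth_rel sesT (GrothGen (g (f A))) (GrothGen A)) ->
  cancel (groth_map (sesT := sesT) sesU f) (groth_map (sesT := sesU) sesT g).
Proof.
move=> fP gP gfP x; rewrite -(groth_reprK x) !groth_map_pi //.
apply/groth_piP; elim: (groth_repr x) => {x} /=.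
- exact: groth_refl.
- exact: gfP.
- by move=> a; apply: groth_congN.
- by move=> a IHa b; apply: groth_congD.
Qed.

(** * Short exact sequences of vector spaces, elementwise *)

Section ShortExactElements.
Variables (K : fieldType) (U V W : vectType K).
Variables (f : 'Hom(U, V)) (g : 'Hom(V, W)).

Lemma short_exactP :
  short_exact f g <->
  [/\ injective f, forall u, g (f u) = 0,
      forall v, g v = 0 -> exists u, v = f u & forall w, exists v, w = g v].
Proof.
split=> [[/eqP/lker0P finj fg gT] | [finj gf0 gK gT]].
  split=> // [u|v gv0|w].
  - by apply/eqP; rewrite -memv_ker -fg memv_img ?memvf.
  - have: v \in limg f by rewrite fg memv_ker gv0.
    by case/memv_imgP=> u _ ->; exists u.
  - by have: w \in limg g by [rewrite gT memvf]; case/memv_imgP=> v _ ->; exists v.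
split; first exact/eqP/lker0P.
  apply/vspaceP=> v; rewrite memv_ker; apply/idP/eqP=> [/memv_imgP[u _ ->] //|].
  by case/gK=> u ->; rewrite memv_img ?memvf.
apply/vspaceP=> w; rewrite memvf; have [v ->] := gT w.
by rewrite memv_img ?memvf.
Qed.

End ShortExactElements.

Lemma short_exact_zero (K : fieldType) :
  short_exact (0 : 'Hom('rV[K]_0, 'rV[K]_0)) (0 : 'Hom('rV[K]_0, 'rV[K]_0)).
Proof.
apply/short_exactP; split=> [u v _|u|v _|w]; rewrite ?lfunE //=.
- by rewrite (thinmx0 u) (thinmx0 v).
- by exists 0; rewrite (thinmx0 v) linear0.
- by exists 0; rewrite (thinmx0 w) linear0.
Qed.

Lemma short_exact_iso (K : fieldType) (U V : vectType K) (f : 'Hom(U, V)) :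
  injective f -> (forall v, exists u, v = f u) ->
  short_exact f (0 : 'Hom(V, 'rV[K]_0)).
Proof.
move=> finj fsurj; apply/short_exactP; split=> // [u|w]; first by rewrite lfunE.
by exists 0; rewrite (thinmx0 w) linear0.
Qed.

(** * Direct sums of finite families of vector spaces *)

(* MathComp has no vectType on dependent functions [forall x, F x]: they are
   encoded as a subspace of [I -> K^N], with N the largest dimension. *)
Section DirectSum.
Variables (K : fieldType) (I : finType) (F : I -> vectType K).

Let N : nat := \max_x dim (F x).

Let coord_in (x : I) (v : F x) : {ffun I -> 'rV[K]_N} :=
  [ffun y => if y == x then v2r v *m pid_mx (dim (F x)) else 0].

Let coord_pr (x : I) (w : {ffun I -> 'rV[K]_N}) : F x :=
  r2v (w x *m pid_mx (dim (F x))).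

Let coord_in_linear x : linear (@coord_in x).
Proof.
move=> a u v; apply/ffunP=> y; rewrite !ffunE.
by case: eqP => _; rewrite ?linearP ?scaler0 ?addr0 //= mulmxDl scalemxAl.
Qed.

Let coord_pr_linear x : linear (@coord_pr x).
Proof.
by move=> a u v; rewrite /coord_pr !ffunE mulmxDl -scalemxAl linearP.
Qed.

HB.instance Definition _ x := GRing.isLinear.Build K (F x)
  {ffun I -> 'rV[K]_N} _ (@coord_in x) (@coord_in_linear x).
HB.instance Definition _ x := GRing.isLinear.Build K
  {ffun I -> 'rV[K]_N} (F x) _ (@coord_pr x) (@coord_pr_linear x).

Let coord_inK x : cancel (@coord_in x) (@coord_pr x).
Proof.
move=> v; rewrite /coord_pr /coord_in ffunE eqxx -mulmxA.
by rewrite pid_mx_id ?leq_bigmax // pid_mx_1 mulmx1 v2rK.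
Qed.

Let coord_in_neq x y v : y != x -> coord_pr y (@coord_in x v) = 0.
Proof. by move=> yx; rewrite /coord_pr ffunE (negPf yx) mul0mx linear0. Qed.

(** The sum is the projector onto the families whose row at each [x] is a zero-padded coordinate row
    of a vector of [F x]. *)
Let support : {vspace {ffun I -> 'rV[K]_N}} :=
  limg (\sum_x (linfun (@coord_in x) \o linfun (@coord_pr x)))%VF.

Definition dsum : vectType K := subvs_of support.
Definition dsum_in x : 'Hom(F x, dsum) :=
  (linfun (vsproj support) \o linfun (@coord_in x))%VF.
Definition dsum_pr x : 'Hom(dsum, F x) :=
  (linfun (@coord_pr x) \o linfun vsval)%VF.

Let coord_in_mem x v : @coord_in x v \in support.
Proof.
apply/memv_imgP; exists (coord_in v); rewrite ?memvf // sum_lfunE.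
rewrite (bigD1 x) //= big1 ?addr0 => [|y yx]; rewrite comp_lfunE !lfunE /=.
  by rewrite coord_inK.
by rewrite coord_in_neq // linear0.
Qed.

Lemma dsum_inK x : cancel (dsum_in x) (dsum_pr x).
Proof.
by move=> v; rewrite !comp_lfunE !lfunE /= vsprojK ?coord_in_mem ?coord_inK.
Qed.

Lemma dsum_pr_in_neq x y v : y != x -> dsum_pr y (dsum_in x v) = 0.
Proof.
by move=> yx; rewrite !comp_lfunE !lfunE /= vsprojK ?coord_in_mem ?coord_in_neq.
Qed.

Lemma dsum_sum w : w = \sum_x dsum_in x (dsum_pr x w).
Proof.
apply: subvs_inj; rewrite linear_sum /=.
(* Write [w] as the projector applied to [u]; idempotence of the projector then gives the claim. *)
have /memv_imgP[u _ Eu] := subvsP w.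
under eq_bigr => x _ do
  rewrite !comp_lfunE !lfunE /= vsprojK ?coord_in_mem //.
rewrite Eu sum_lfunE; apply: eq_bigr => x _; rewrite comp_lfunE !lfunE /=.
congr coord_in; rewrite linear_sum (bigD1 x) //= big1 ?addr0 => [|y yx].
  by rewrite comp_lfunE !lfunE /= coord_inK.
by rewrite comp_lfunE !lfunE /= coord_in_neq // eq_sym.
Qed.

Lemma dsum_pr_inj v w : (forall x, dsum_pr x v = dsum_pr x w) -> v = w.
Proof.
by move=> E; rewrite (dsum_sum v) (dsum_sum w); apply: eq_bigr => x _; rewrite E.
Qed.

Lemma dsum_pr_sum x (u : forall y, F y) :
  dsum_pr x (\sum_y dsum_in y (u y)) = u x.
Proof.
rewrite linear_sum (bigD1 x) //= dsum_inK big1 ?addr0 // => y yx.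
by rewrite dsum_pr_in_neq // eq_sym.
Qed.

End DirectSum.

Arguments dsum_in {K I F} x.
Arguments dsum_pr {K I F} x.

(** * The module over the double built from a twisted representation *)

Section TotalRep.
Variables (C : numClosedFieldType) (gT : finGroupType).
Variable omega : cocycle3 C gT.

Local Notation D := (drinfeld_double omega).
Local Notation twRep := (twistedRep (transgression omega)).

Definition conj_arrow (g x : gT) : loop_hom x (cj g x) :=
  exist _ g (eqxx (cj g x)).

Section Action.
Variable F : twRep.

Local Notation tot := (dsum (fun x : gT => trep_space F x)).
Local Notation tot_in := (@dsum_in C gT (fun x : gT => trep_space F x)).
Local Notation tot_pr := (@dsum_pr C gT (fun x : gT => trep_space F x)).

Definition tot_basis_act (p : gT * gT) : 'End(tot) :=
  (tot_in (cj p.1 p.2) \o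
     @trep_map _ _ _ F p.2 (cj p.1 p.2) (conj_arrow p.1 p.2) \o
     tot_pr p.2)%VF.

Definition tot_act (a : D) : 'End(tot) := \sum_p a p *: tot_basis_act p.

Lemma tot_act_linear : linear tot_act.
Proof.
move=> c a b; rewrite /tot_act scaler_sumr -big_split; apply: eq_bigr => p _ /=.
by rewrite dd_ffunD dd_ffunZ scalerDl scalerA.
Qed.

HB.instance Definition _ :=
  GRing.isLinear.Build C D 'End(tot) _ tot_act tot_act_linear.

Lemma tot_act_basis g x : tot_act (dd_basis omega g x) = tot_basis_act (g, x).
Proof.
rewrite /tot_act (bigD1 (g, x)) //= dd_basisE eqxx scale1r big1 ?addr0 //.
by move=> p px; rewrite dd_basisE (negPf px) scale0r.
Qed.

(* Stated for an arbitrary arrow [g : x -> y], so that [y] need not be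
   syntactically [cj (val g) x]. *)
Lemma tot_act_arrow (x y : loop_groupoid gT) (g : ghom x y) w :
  tot_act (dd_basis omega (val g) x) w = tot_in y (trep_map F g (tot_pr x w)).
Proof.
(* Once [y] is replaced by [cj g x], the two arrows differ only in a proof of a boolean equality,
   and such proofs are unique. *)
case: g => g /= yg; have /eqP E := yg; move: yg; rewrite {}E => yg.
rewrite tot_act_basis /tot_basis_act /= !comp_lfunE /=.
by rewrite /conj_arrow /= (eq_irrelevance yg (eqxx _)).
Qed.

(** Each [<-e- x>] acts as projection to [F x] followed by inclusion, and these operators sum to the
    identity. *)
Lemma tot_act1 : tot_act 1 = \1%VF.
Proof.
apply/lfunP=> w; rewrite (_ : 1 = dd_one omega) // linear_sum sum_lfunE.
rewrite [RHS]lfunE /= [RHS]dsum_sum.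
apply: eq_bigr => x _; rewrite (tot_act_arrow (@gid (loop_groupoid gT) x)).
by rewrite trep_map1 id_lfunE.
Qed.

Lemma tot_actM_basis (p q : gT * gT) :
  tot_act (dd_basis omega p.1 p.2 * dd_basis omega q.1 q.2)
  = (tot_act (dd_basis omega p.1 p.2) \o tot_act (dd_basis omega q.1 q.2))%VF.
Proof.
case: p q => [h y] [g x] /=; apply/lfunP=> w; rewrite comp_lfunE dd_basisM.
rewrite (tot_act_arrow (conj_arrow g x)).
rewrite (tot_act_arrow (conj_arrow h y)).
(* For non-composable arrows the product is zero, and so is the composite, since it projects one
   summand to a different one. *)
have [->|yx] := eqVneq y (cj g x); last first.
  by rewrite linear0 lfunE /= dsum_pr_in_neq // !linear0.
rewrite dsum_inK linearZ scale_lfunE /=.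
rewrite -[trep_map F (conj_arrow h _) _]comp_lfunE trep_mapM scale_lfunE linearZ.
congr (_ *: _).
(* The targets [cj (h * g) x] and [cj h (cj g x)] are equal but not convertible, hence the form of
   the action for an arbitrary arrow. *)
exact: (tot_act_arrow (@gcomp (loop_groupoid gT) _ _ _
  (conj_arrow h (cj g x)) (conj_arrow g x))).
Qed.

Lemma tot_actM a b : tot_act (a * b) = (tot_act a \o tot_act b)%VF.
Proof.
rewrite [a]dd_decomp [b]dd_decomp mulr_suml !linear_sum.
apply/lfunP=> w; rewrite comp_lfunE !sum_lfunE; apply: eq_bigr => p _.
rewrite mulr_sumr linear_sum sum_lfunE linear_sum; apply: eq_bigr => q _.
rewrite -scalerAl -scalerAr !linearZ /= tot_actM_basis !scale_lfunE comp_lfunE.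
by rewrite [tot_act _ (_ *: _)]linearZ !scalerA mulrC.
Qed.

Definition tot_rep : algRep D :=
  @AlgRep C D tot tot_act tot_act1 tot_actM.

Lemma tot_rep_basis g x w :
  rep_act tot_rep (dd_basis omega g x) w =
  tot_in (cj g x)
    (@trep_map _ _ _ F x (cj g x) (conj_arrow g x) (tot_pr x w)).
Proof. exact: (tot_act_arrow (conj_arrow g x)). Qed.

End Action.

(** * Exactness of the total module construction *)

Lemma algRep_morph_basis (V W : algRep D) (f : 'Hom(rep_space V, rep_space W)) :
  (forall g x v, f (rep_act V (dd_basis omega g x) v)
                 = rep_act W (dd_basis omega g x) (f v)) ->
  algRep_morph f.
Proof.
move=> fP a; apply/lfunP=> v; rewrite !comp_lfunE [a]dd_decomp !linear_sum.
rewrite !sum_lfunE linear_sum; apply: eq_bigr => p _.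
by rewrite !linearZ !scale_lfunE linearZ /= fP.
Qed.

Section TotalMorphism.
Variables (E F : twRep).
Variable t : forall x : gT, 'Hom(trep_space E x, trep_space F x).

Definition tot_map : 'Hom(rep_space (tot_rep E), rep_space (tot_rep F)) :=
  (\sum_(x : gT) (dsum_in x \o t x \o dsum_pr x))%VF.

Lemma tot_mapE w : tot_map w = \sum_x dsum_in x (t x (dsum_pr x w)).
Proof. by rewrite sum_lfunE; apply: eq_bigr => x _; rewrite !comp_lfunE. Qed.

Lemma dsum_pr_tot_map x w : dsum_pr x (tot_map w) = t x (dsum_pr x w).
Proof. by rewrite tot_mapE (dsum_pr_sum x (fun y => t y (dsum_pr y w))). Qed.

Lemma tot_map_in x u : tot_map (dsum_in x u) = dsum_in x (t x u).
Proof.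
apply: dsum_pr_inj => y; rewrite dsum_pr_tot_map.
have [->|yx] := eqVneq y x; first by rewrite !dsum_inK.
by rewrite !dsum_pr_in_neq // linear0.
Qed.

Lemma tot_map_morph :
  @trep_morph _ (loop_groupoid gT) _ E F t -> algRep_morph tot_map.
Proof.
move=> tP; apply: algRep_morph_basis => g x w.
rewrite !tot_rep_basis tot_map_in dsum_pr_tot_map.
by have := tP _ _ (conj_arrow g x) => /lfunP/(_ (dsum_pr x w)); rewrite !comp_lfunE => ->.
Qed.

End TotalMorphism.

Lemma tot_rep_exact (E F H : twRep) :
  trep_ses E F H -> algRep_ses (tot_rep E) (tot_rep F) (tot_rep H).
Proof.
case=> s [t [sP tP st]]; exists (tot_map s), (tot_map t).
split; [exact: tot_map_morph | exact: tot_map_morph | apply/short_exactP].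
have {}st x := (short_exactP (s x) (t x)).1 (st x).
split=> [u v uv|u|v tv0|w].
- apply: dsum_pr_inj => x; have [sinj _ _ _] := st x.
  by apply: sinj; rewrite -!dsum_pr_tot_map uv.
- apply: dsum_pr_inj => x; have [_ ts0 _ _] := st x.
  by rewrite !dsum_pr_tot_map ts0 linear0.
- have tvx x : t x (dsum_pr x v) = 0 by rewrite -dsum_pr_tot_map tv0 linear0.
  (* Preimages are chosen in every component at once, so that they can be summed to one in the total
     space. *)
  have u x : {u | dsum_pr x v = s x u}.
    by apply: cid; have [_ _ /(_ _ (tvx x))] := st x.
  exists (\sum_x dsum_in x (sval (u x))); apply: dsum_pr_inj => x.
  by rewrite dsum_pr_tot_map dsum_pr_sum -(svalP (u x)).
- have v x : {v | dsum_pr x w = t x v}.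
    by apply: cid; have [_ _ _ /(_ (dsum_pr x w))] := st x.
  exists (\sum_x dsum_in x (sval (v x))); apply: dsum_pr_inj => x.
  by rewrite dsum_pr_tot_map dsum_pr_sum -(svalP (v x)).
Qed.

(** * Exactness of the passage from a module to its components *)

Section SupportMorphism.
Variables (V W : algRep D) (f : 'Hom(rep_space V, rep_space W)).

Definition supp_hom (x : gT) :
    'Hom(subvs_of (supp_space V x), subvs_of (supp_space W x)) :=
  (linfun (vsproj (supp_space W x)) \o f \o linfun vsval)%VF.

Hypothesis fP : algRep_morph f.

Lemma algRep_morphE a v : f (rep_act V a v) = rep_act W a (f v).
Proof. by rewrite -!comp_lfunE fP. Qed.

(** A module morphism commutes with [<-e- x>], hence maps its image into its image, and [vsproj] in
    [supp_hom] changes nothing. *)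
Lemma supp_homE x u : vsval (supp_hom x u) = f (vsval u).
Proof.
rewrite !comp_lfunE !lfunE /= vsprojK // -(supp_act1 (subvsP u)) algRep_morphE.
by rewrite memv_img ?memvf.
Qed.

Lemma supp_hom_morph :
  @trep_morph _ (loop_groupoid gT) _ (supp_rep V) (supp_rep W) supp_hom.
Proof.
move=> x y g; apply/lfunP=> u; apply: subvs_inj; rewrite comp_lfunE supp_homE.
by rewrite comp_lfunE !supp_mapE supp_homE algRep_morphE.
Qed.

End SupportMorphism.

Definition supp_pr (V : algRep D) (x : gT) (v : rep_space V) :
    subvs_of (supp_space V x) := vsproj _ (rep_act V (dd_basis omega 1%g x) v).

Lemma supp_prE (V : algRep D) x (v : rep_space V) :
  vsval (supp_pr x v) = rep_act V (dd_basis omega 1%g x) v.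
Proof. by rewrite vsprojK ?memv_img ?memvf. Qed.

Lemma supp_rep_exact (U V W : algRep D) :
  algRep_ses U V W -> trep_ses (supp_rep U) (supp_rep V) (supp_rep W).
Proof.
case=> f [g [fP gP /short_exactP[finj gf0 gK gT']]].
exists (supp_hom f), (supp_hom g).
split; [exact: supp_hom_morph | exact: supp_hom_morph | move=> x].
apply/short_exactP; split=> [u v uv|u|v gv0|w].
- by apply/subvs_inj/finj; rewrite -!supp_homE // uv.
- by apply/subvs_inj; rewrite !supp_homE ?gf0.
- have /gK[u Eu] : g (vsval v) = 0 by rewrite -supp_homE // gv0.
  (* The preimage [u] may lie outside the [x]-component. Applying [<-e- x>] moves it there and keeps
     it a preimage, because this idempotent commutes with [f] and fixes [v]. *)
  exists (supp_pr x u); apply/subvs_inj.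
  by rewrite supp_homE // supp_prE algRep_morphE // -Eu supp_act1 ?subvsP.
- have [v Ev] := gT' (vsval w); exists (supp_pr x v); apply/subvs_inj.
  by rewrite supp_homE // supp_prE algRep_morphE // -Ev supp_act1 ?subvsP.
Qed.

(** * The two constructions are mutually inverse up to isomorphism *)

Lemma supp_tot (F : twRep) :
  exists t, @trep_morph _ (loop_groupoid gT) _ F (supp_rep (tot_rep F)) t
    /\ forall x, injective (t x) /\ forall w, exists v, w = t x v.
Proof.
pose t x : 'Hom(trep_space F x, subvs_of (supp_space (tot_rep F) x)) :=
  (linfun (vsproj (supp_space (tot_rep F) x)) \o dsum_in x)%VF.
(* The image of [<-e- x>] on the total space is thus the copy of [F x], which makes [t x] an
   isomorphism. *)
have act1 (x : loop_groupoid gT) (w : rep_space (tot_rep F)) :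
    rep_act (tot_rep F) (dd_basis omega 1%g x) w = dsum_in x (dsum_pr x w).
  by rewrite /= (tot_act_arrow (gid x)) trep_map1 id_lfunE.
have tE (x : loop_groupoid gT) u : vsval (t x u) = dsum_in x u.
  rewrite comp_lfunE lfunE /= vsprojK //.
  by rewrite -[X in dsum_in x X]dsum_inK -act1 memv_img ?memvf.
exists t; split=> [x y g|x].
  apply/lfunP=> u; apply: subvs_inj; rewrite comp_lfunE tE.
  rewrite [X in _ = vsval X]comp_lfunE supp_mapE tE.
  by rewrite /= tot_act_arrow dsum_inK.
split=> [u v /(congr1 vsval)|w]; first by rewrite !tE => /(can_inj (@dsum_inK _ _ _ x)).
exists (dsum_pr x (vsval w)); apply: subvs_inj.
by rewrite tE -act1 supp_act1 ?subvsP.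
Qed.

(** The map adds up the components. It is injective because [<-e- x>] recovers the component at [x]
    from the sum, and surjective because the unit is the sum of the [<-e- x>]. *)
Lemma tot_supp (V : algRep D) :
  exists f : 'Hom(rep_space (tot_rep (supp_rep V)), rep_space V),
    [/\ algRep_morph f, injective f & forall v, exists w, v = f w].
Proof.
pose S (x : gT) : vectType C := subvs_of (supp_space V x).
pose f : 'Hom(rep_space (tot_rep (supp_rep V)), rep_space V) :=
  (\sum_(x : gT)
      (linfun (vsval (U := supp_space V x)) \o @dsum_pr _ _ S x))%VF.
have fE w : f w = \sum_x vsval (@dsum_pr _ _ S x w).
  by rewrite sum_lfunE; apply: eq_bigr => x _; rewrite !comp_lfunE lfunE.
have f_in x u : f (@dsum_in _ _ S x u) = vsval u.
  rewrite fE (bigD1 x) //= dsum_inK big1 ?addr0 // => y yx.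
  by rewrite dsum_pr_in_neq.
have act_f g x w : rep_act V (dd_basis omega g x) (f w)
    = rep_act V (dd_basis omega g x) (vsval (@dsum_pr _ _ S x w)).
  rewrite fE linear_sum (bigD1 x) //= big1 ?addr0 // => y yx.
  (* A vector of the [y]-component is fixed by [<-e- y>], and [<-g- x>] times [<-e- y>] vanishes for
     [y] different from [x]. *)
  rewrite -(supp_act1 (subvsP (dsum_pr y w))) -comp_lfunE -rep_actM dd_basisM.
  by rewrite cj1 eq_sym (negPf yx) linear0 lfunE.
exists f; split=> [|u v fuv|v].
- apply: algRep_morph_basis => g x w.
  by rewrite tot_rep_basis f_in supp_mapE act_f.
- apply: (@dsum_pr_inj _ _ S) => x; apply: subvs_inj.
  have := congr1 (rep_act V (dd_basis omega 1%g x)) fuv.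
  by rewrite !act_f !supp_act1 ?subvsP.
- exists (\sum_x @dsum_in _ _ S x (supp_pr x v)).
  rewrite linear_sum -[LHS]id_lfunE -(rep_act1 V) (_ : 1 = dd_one omega) //.
  rewrite linear_sum sum_lfunE; apply: eq_bigr => x _.
  by rewrite /= f_in supp_prE.
Qed.

Lemma tot_supp_rel (V : algRep D) :
  groth_rel (@algRep_ses C D)
    (GrothGen (tot_rep (supp_rep V))) (GrothGen V).
Proof.
pose z : {linear D -> 'End('rV[C]_0)} := \0.
have z1 : z 1 = \1%VF by apply/lfunP=> v; rewrite (thinmx0 v) !linear0.
have zM a b : z (a * b) = (z a \o z b)%VF.
  by apply/lfunP=> v; rewrite (thinmx0 v) !linear0.
pose Z : algRep D := AlgRep z1 zM.
have [f [fP finj fsurj]] := tot_supp V.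
have morph0 W : algRep_morph (0 : 'Hom(rep_space W, rep_space Z)).
  by move=> a; apply/lfunP=> v; rewrite [LHS]thinmx0 [RHS]thinmx0.
(* Symmetry is needed since [f] goes from the rebuilt module to [V]; the map of [supp_tot] starts at
   the given object instead. *)
apply: groth_sym; apply: (groth_rel_iso (Z := Z)).
  by exists 0, 0; split=> //; apply: short_exact_zero.
by exists f, 0; split=> //; apply: short_exact_iso.
Qed.

Lemma supp_tot_rel (F : twRep) :
  groth_rel (@trep_ses C (loop_groupoid gT) (transgression omega))
    (GrothGen (supp_rep (tot_rep F))) (GrothGen F).
Proof.
pose S (x : loop_groupoid gT) : vectType C := 'rV[C]_0.
pose m (x y : loop_groupoid gT) (g : ghom x y) : 'Hom(S x, S y) := 0.
have m1 x : m _ _ (gid x) = \1%VF.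
  by apply/lfunP=> v; rewrite (thinmx0 v) !linear0.
have mM x y z (h : ghom y z) (g : ghom x y) :
    (m _ _ h \o m _ _ g)%VF = transgression omega x y z h g *: m _ _ (gcomp h g).
  by apply/lfunP=> v; rewrite (thinmx0 v) !linear0.
pose Z : twRep := TwistedRep m1 mM.
have [t [tP tiso]] := supp_tot F.
have morph0 E : @trep_morph _ (loop_groupoid gT) _ E Z (fun=> 0).
  by move=> x y g; apply/lfunP=> v; rewrite [LHS]thinmx0 [RHS]thinmx0.
apply: (groth_rel_iso (Z := Z)).
  by exists (fun=> 0), (fun=> 0); split=> // x; apply: short_exact_zero.
exists t, (fun=> 0); split=> // x.
by have [tinj tsurj] := tiso x; apply: short_exact_iso.
Qed.

End TotalRep.

(** Naturality is expressed by the last clause: the classes generate the group, so their images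
    determine the additive map [Phi]. *)
Theorem proposition18 (R : realType) (gT : finGroupType)
    (omega : cocycle3 R[i] gT) :
  exists Phi : dd_rep_group omega -> twisted_K omega,
    [/\ {morph Phi : a b / dd_rep_add a b >-> twisted_K_add a b},
        bijective Phi
      & forall V : algRep (drinfeld_double omega),
          Phi (dd_rep_class V) = twisted_K_class (supp_rep V)].
Proof.
have suppP := @supp_rep_exact _ _ omega; have totP := @tot_rep_exact _ _ omega.
exists (groth_map _ (@supp_rep _ _ omega)); split.
- exact: groth_mapD.
- exists (groth_map _ (@tot_rep _ _ omega)); apply: groth_mapK => //.
  + exact: tot_supp_rel.
  + exact: supp_tot_rel.
- by move=> V; rewrite /dd_rep_class /rep_class /groth_class groth_map_pi.
Qed.
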